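(* Let $\mu$ be a Borel probability measure on $[0,1)$ with Höffding measure $\lambda_\mu$, let $\Lambda_\mu$ be the marginal of $\lambda_\mu$, and let $\sigma^2$ be the variance of $\mu$. Let $c\in\mathbb{R}$. Then there exists a unique mixing measure $\lambda$ for $\mu$ whose marginal distribution is equal to $c\mu$, and it is given by $$ \lambda=\lambda_\mu+(\sigma^2-c)\,m\otimes m+c\,(\mu\otimes m+m\otimes\mu)-(\Lambda_\mu\otimes m+m\otimes\Lambda_\mu). $$
   Context: $m$ denotes the uniform probability measure (Lebesgue measure) on $[0,1)$. For a probability measure $\mu$ on $[0,1)$ with distribution function $F(x)=\mu((-\infty,x])$, the Höffding measure $\lambda_\mu$ is the finite positive measure with Lebesgue density $H_\mu(x,y)=F(\min(x,y))\,(1-F(\max(x,y)))$; it is supported on the square and is regarded as a measure on $[0,1)\times[0,1)$. Its marginal is $\Lambda_\mu(A)=\lambda_\mu(A\times[0,1))$. Signed measures are finite. A mixing measure for $\mu$ is a signed Borel measure $\lambda$ on $[0,1)\times[0,1)$, symmetric about the diagonal $x=y$, such that $$\mathrm{cov}_\mu(u,v)=\int_0^1\int_0^1 u'(x)\,v'(y)\,d\lambda(x,y)$$ for all $1$-periodic smooth ($C^1$) functions $u,v$ on $\mathbb{R}$, where $\mathrm{cov}_\mu(u,v)=\int uv\,d\mu-\int u\,d\mu\int v\,d\mu$. The marginal of a symmetric signed measure $\lambda$ is $A\mapsto\lambda(A\times[0,1))$. *)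

(* Defs.v *)
From HB Require Import structures.
From mathcomp Require Import all_boot all_order all_algebra.
From mathcomp Require Import all_classical all_reals all_analysis.
From mathcomp Require Import measurable_realfun.

Set Implicit Arguments.
Unset Strict Implicit.
Unset Printing Implicit Defensive.

Import Order.TTheory GRing.Theory Num.Theory.
Import numFieldNormedType.Exports.

Local Open Scope classical_set_scope.
Local Open Scope ring_scope.
Local Open Scope ereal_scope.

(* A Borel (signed) measure on [0, 1) is encoded as a (signed) Borel measure  *)
(* on the real line that is carried by [0, 1), and similarly for the square.  *)
(* Values on non-measurable sets are junk, so (signed) measures should only   *)
(* be compared on measurable sets.                                            *)

Definition carried_by d (T : measurableType d) (R : realType) (D : set T)
    (nu : set T -> \bar R) : Prop :=
  forall A, measurable A -> nu A = nu (A `&` D).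

Section unit_interval.
Context (R : realType).

Definition unit_itv : set (measurableTypeR R) := `[0%R, 1%R[.

Definition unit_square : set (measurableTypeR R * measurableTypeR R)%type :=
  unit_itv `*` unit_itv.

Lemma measurable_unit_itv : measurable unit_itv.
Proof. exact: measurable_itv. Qed.

Lemma measurable_unit_square : measurable unit_square.
Proof. by apply: measurableX; exact: measurable_unit_itv. Qed.

Lemma lebesgue_measure_unit_itv : lebesgue_measure unit_itv = 1.
Proof. by rewrite lebesgue_measure_itv/= lte_fin ltr01 oppr0 adde0. Qed.

Lemma lebesgue_measure_unit_itv_lty : lebesgue_measure unit_itv < +oo.
Proof. by rewrite lebesgue_measure_unit_itv ltry. Qed.

Definition unit_lebesgue : set (measurableTypeR R) -> \bar R :=
  mfrestr measurable_unit_itv lebesgue_measure_unit_itv_lty.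

HB.instance Definition _ := FiniteMeasure.on unit_lebesgue.

Let unit_lebesgue_setT : unit_lebesgue setT = 1.
Proof.
rewrite /unit_lebesgue /mfrestr /mrestr setTI.
exact: lebesgue_measure_unit_itv.
Qed.

HB.instance Definition _ :=
  Measure_isProbability.Build _ _ _ unit_lebesgue unit_lebesgue_setT.

Definition marginal (nu : set (measurableTypeR R * measurableTypeR R)%type -> \bar R)
  (A : set (measurableTypeR R)) : \bar R := nu (A `*` unit_itv).

Section marginal_finite_measure.
Variable nu :
  {finite_measure set (measurableTypeR R * measurableTypeR R)%type -> \bar R}.

Let marginal0 : marginal nu set0 = 0.
Proof. by rewrite /marginal set0X measure0. Qed.

Let marginal_ge0 A : 0 <= marginal nu A.
Proof. exact: measure_ge0. Qed.

Let marginal_sigma_additive : semi_sigma_additive (marginal nu).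
Proof.
move=> F mF tF mUF; rewrite /marginal.
have -> : \bigcup_n F n `*` unit_itv = \bigcup_n (F n `*` unit_itv).
  by apply/seteqP; split=> [[x y] [[n _ /= Fnx] Iy]|[x y] [n _ [/= Fnx Iy]]];
    [exists n|split=> //; exists n].
have mFI n : measurable (F n `*` unit_itv).
  by apply: measurableX => //; exact: measurable_unit_itv.
apply: measure_semi_sigma_additive => //; last exact: bigcup_measurable.
apply/trivIsetP => i j _ _ ij; rewrite -subset0 => -[x y] [[/= Fix _] [Fjx _]].
move/trivIsetP : tF => /(_ i j Logic.I Logic.I ij).
by rewrite -subset0 => /(_ x); apply.
Qed.

HB.instance Definition _ := isMeasure.Build _ _ _ (marginal nu)
  marginal0 marginal_ge0 marginal_sigma_additive.

Let marginal_fin : fin_num_fun (marginal nu).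
Proof.
move=> A mA; apply: fin_num_measure.
by apply: measurableX => //; exact: measurable_unit_itv.
Qed.

HB.instance Definition _ := Measure_isFinite.Build _ _ _
  (marginal nu) marginal_fin.

End marginal_finite_measure.

End unit_interval.
Arguments unit_itv R : clear implicits.
Arguments unit_square R : clear implicits.
Arguments unit_lebesgue R : clear implicits.

Section hoeffding_measure.
Context (R : realType) (mu : probability (measurableTypeR R) R).
Local Open Scope ring_scope.

Definition distribution_function (x : R) : R := fine (mu `]-oo, x]%classic).

Local Notation F := distribution_function.

Definition hoeffding_density (z : R * R) : R :=
  F (Num.min z.1 z.2) * (1 - F (Num.max z.1 z.2)).

Lemma distribution_function_ge0 x : 0 <= F x.
Proof. exact: fine_ge0. Qed.

Lemma distribution_function_le1 x : F x <= 1.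
Proof.
have mF : measurable (`]-oo, x]%classic : set (measurableTypeR R)).
  exact: measurable_itv.
by rewrite -lee_fin fineK ?fin_num_measure// probability_le1.
Qed.

Lemma nondecreasing_distribution_function : {homo F : x y / x <= y}.
Proof.
move=> x y xy.
have mF z : measurable (`]-oo, z]%classic : set (measurableTypeR R)).
  exact: measurable_itv.
rewrite fine_le ?fin_num_measure// le_measure ?inE//.
by move=> z /=; rewrite !in_itv/= => /le_trans; apply.
Qed.

Lemma hoeffding_density_ge0 z : 0 <= hoeffding_density z.
Proof.
by rewrite mulr_ge0 ?distribution_function_ge0// subr_ge0
  distribution_function_le1.
Qed.

Lemma hoeffding_density_le1 z : hoeffding_density z <= 1.
Proof.
by rewrite mulr_ile1 ?distribution_function_ge0 ?distribution_function_le1//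
  ?subr_ge0 ?distribution_function_le1// gerBl distribution_function_ge0.
Qed.

Lemma measurable_distribution_function :
  measurable_fun [set: measurableTypeR R] (F : measurableTypeR R -> R).
Proof.
apply: nondecreasing_measurable => //.
exact: nondecreasing_distribution_function.
Qed.

Lemma measurable_hoeffding_density :
  measurable_fun [set: (measurableTypeR R * measurableTypeR R)%type]
    (hoeffding_density : (measurableTypeR R * measurableTypeR R)%type -> R).
Proof.
apply: measurable_funM.
  apply: (measurableT_comp measurable_distribution_function).
  by apply: measurable_minr; [exact: measurable_fst|exact: measurable_snd].
apply: measurable_funB => //.
apply: (measurableT_comp measurable_distribution_function).
by apply: measurable_maxr; [exact: measurable_fst|exact: measurable_snd].
Qed.

Local Open Scope ereal_scope.

(* The density vanishes outside of the unit square when mu is carried by      *)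
(* [0, 1); the restriction to the square makes the measure finite whatever mu.*)
Definition hoeffding (A : set (measurableTypeR R * measurableTypeR R)%type) :
    \bar R :=
  \int[lebesgue_measure \x lebesgue_measure]_(z in A `&` unit_square R)
    (hoeffding_density z)%:E.

Let hoeffding0 : hoeffding set0 = 0.
Proof. by rewrite /hoeffding set0I integral_set0. Qed.

Let hoeffding_ge0 A : 0 <= hoeffding A.
Proof.
by apply: integral_ge0 => z _; rewrite lee_fin hoeffding_density_ge0.
Qed.

Let hoeffding_sigma_additive : semi_sigma_additive hoeffding.
Proof.
move=> A mA tA mUA; rewrite /hoeffding; apply: cvg_toP.
  apply: ereal_nondecreasing_is_cvgn => m n mn.
  apply: lee_sum_nneg_natr => // k _ _.
  exact: hoeffding_ge0.
rewrite setI_bigcupl ge0_integral_bigcup//=.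
- by move=> k; apply: measurableI => //; exact: measurable_unit_square.
- apply: measurable_funTS; apply/measurable_EFinP.
  exact: measurable_hoeffding_density.
- by move=> z _; rewrite lee_fin hoeffding_density_ge0.
- exact: trivIset_setIr.
Qed.

HB.instance Definition _ := isMeasure.Build _ _ _ hoeffding
  hoeffding0 hoeffding_ge0 hoeffding_sigma_additive.

Let hoeffding_fin : fin_num_fun hoeffding.
Proof.
move=> A mA; rewrite ge0_fin_numE ?hoeffding_ge0//.
have mAS : measurable (A `&` unit_square R).
  by apply: measurableI => //; exact: measurable_unit_square.
apply: (@le_lt_trans _ _ (\int[lebesgue_measure \x lebesgue_measure]_(z in
    A `&` unit_square R) (cst 1 z))).
  apply: ge0_le_integral => //=.
  - by move=> z _; rewrite lee_fin hoeffding_density_ge0.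
  - apply: measurable_funTS; apply/measurable_EFinP.
    exact: measurable_hoeffding_density.
  - by move=> z _; rewrite lee_fin hoeffding_density_le1.
rewrite integral_cst// mul1e.
apply: (@le_lt_trans _ _
    ((lebesgue_measure \x lebesgue_measure)%E (unit_square R))).
  by apply: le_measure; rewrite ?inE//; exact: measurable_unit_square.
rewrite product_measure1E; [|exact: measurable_unit_itv..].
apply: lte_mul_pinfty => //; first by rewrite [X in X \is a _]lebesgue_measure_unit_itv.
exact: lebesgue_measure_unit_itv_lty.
Qed.

HB.instance Definition _ := Measure_isFinite.Build _ _ _
  hoeffding hoeffding_fin.

End hoeffding_measure.

Section charge_integral.
Context d (T : measurableType d) (R : realType).
Variable nu : {charge set T -> \bar R}.

Lemma Hahn_pair :
  exists PN : set T * set T, hahn_decomposition nu PN.1 PN.2.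
Proof. by have [P [N PN]] := Hahn_decomposition nu; exists (P, N). Qed.

(* Integral against a signed measure, through its Jordan decomposition; by    *)
(* Hahn_decomposition_uniq the choice of the Hahn decomposition is immaterial.*)
Definition charge_Rintegral (D : set T) (f : T -> R) : R :=
  let nuPN := projT2 (cid Hahn_pair) in
  (\int[jordan_pos nuPN]_(z in D) f z - \int[jordan_neg nuPN]_(z in D) f z)%R.

End charge_integral.

Section mixing_measure.
Context (R : realType).
Local Open Scope ring_scope.

Definition periodic_C1 (u : R -> R) : Prop :=
  [/\ forall x, derivable u x 1, continuous (u^`()%classic) & periodic u 1].

Definition cov (mu : probability (measurableTypeR R) R) (u v : R -> R) : R :=
  \int[mu]_x (u x * v x) - (\int[mu]_x u x) * (\int[mu]_x v x).

Definition mixing_measure (mu : probability (measurableTypeR R) R)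
    (lambda : {charge set (measurableTypeR R * measurableTypeR R)%type -> \bar R}) :
    Prop :=
  [/\ carried_by (unit_square R) lambda,
      forall A, measurable A -> lambda [set z | A (z.2, z.1)] = lambda A
    & forall u v : R -> R, periodic_C1 u -> periodic_C1 v ->
        cov mu u v = charge_Rintegral lambda (unit_square R)
                       (fun z => (u^`() z.1)%classic * (v^`() z.2)%classic)].

End mixing_measure.

(* Main.v *)
Require Import Defs.
From HB Require Import structures.
From mathcomp Require Import all_boot all_order all_algebra.
From mathcomp Require Import all_classical all_reals all_analysis.
From mathcomp Require Import measurable_realfun ring lra.

(** The idea is that a mixing measure is only tested against derivatives of
periodic functions, and that these are exactly the continuous periodic
functions of mean zero.

Existence. Hoeffding's formula ([Rintegral_hoeffding]) says that the Hoeffding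
measure represents the covariance of all continuously differentiable functions.
It comes from writing the distribution function F x as the integral of the
indicator of s <= x over the law of s, from Fubini's theorem, and from
integrating u' over [s, 1]. A measure with a uniform factor can be added freely,
because u' integrates to zero over a period. The terms added to the Hoeffding
measure are of this form, and their coefficients are such that the marginal
becomes c mu ([mixing_candidate_marginal]). That computation needs the total
mass of the Hoeffding measure to be the variance, which is Hoeffding's formula
again, for two identity functions ([variance_hoeffding]); this is why the
formula is proved without periodicity.

Uniqueness. Let delta be the difference of two solutions. It integrates u'(x)
v'(y) to zero for all periodic u and v, and both of its marginals vanish, by
symmetry. A continuous periodic function f is the sum of its mean and of a
derivative ([periodic_primitive]), and integrals of functions of one variable
only see the marginals, hence delta integrates f(x) g(y) to zero for all
continuous periodic f and g. By dominated convergence delta vanishes on the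
rectangles whose sides are of the form {f > 0}. These are stable under
intersection, and they generate the Borel sets since an arc ]a, 1[ is the subset
of [0, 1[ where sin (pi (x - a)) sin (pi x) is positive. To apply the uniqueness
theorem for positive measures, delta is written as the difference of two of them
([eq_measure_of_derivatives], [mixing_measure_unique]). *)

Set Implicit Arguments.
Unset Strict Implicit.
Unset Printing Implicit Defensive.

Import Order.TTheory GRing.Theory Num.Theory.
Import numFieldNormedType.Exports.

Local Open Scope ring_scope.
Local Open Scope classical_set_scope.

(** * Bounded measurable functions *)

Section bounded_measurable.
Context d (T : measurableType d) (R : realType).
Implicit Types (D : set T) (f g : T -> R).

Definition bounded_measurable D f :=
  measurable_fun D f /\ exists M : R, forall x, D x -> `|f x| <= M.

Lemma bounded_measurable_cst D (r : R) : bounded_measurable D (fun=> r).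
Proof. by split; [exact: measurable_cst|exists `|r|]. Qed.

Lemma bounded_measurableD D f g : bounded_measurable D f ->
  bounded_measurable D g -> bounded_measurable D (fun x => f x + g x).
Proof.
move=> [mf [M fM]] [mg [N gN]]; split; first exact: measurable_funD.
by exists (M + N) => x Dx; rewrite (le_trans (ler_normD _ _))// lerD ?fM ?gN.
Qed.

Lemma bounded_measurableM D f g : bounded_measurable D f ->
  bounded_measurable D g -> bounded_measurable D (fun x => f x * g x).
Proof.
move=> [mf [M fM]] [mg [N gN]]; split; first exact: measurable_funM.
by exists (M * N) => x Dx; rewrite normrM ler_pM ?fM ?gN.
Qed.

Lemma bounded_measurableN D f : bounded_measurable D f ->
  bounded_measurable D (fun x => - f x).
Proof.
move=> [mf [M fM]]; split; first exact: measurableT_comp.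
by exists M => x Dx; rewrite normrN fM.
Qed.

Lemma bounded_measurableB D f g : bounded_measurable D f ->
  bounded_measurable D g -> bounded_measurable D (fun x => f x - g x).
Proof.
by move=> bf bg; apply: bounded_measurableD => //; exact: bounded_measurableN.
Qed.

Lemma bounded_measurable_indic D (A : set T) : measurable A ->
  bounded_measurable D (\1_A : T -> R).
Proof.
move=> mA; split; first exact: measurable_indic.
by exists 1 => x _; rewrite indicE; case: (_ \in _); rewrite ?normr1 ?normr0.
Qed.

Lemma bounded_measurable_integrable D f
    (nu : {finite_measure set T -> \bar R}) : measurable D ->
  bounded_measurable D f -> nu.-integrable D (EFin \o f).
Proof.
move=> mD [mf [M fM]]; apply: measurable_bounded_integrable => //.
  by rewrite -ge0_fin_numE// fin_num_measure.
exists M; split; first exact: num_real.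
by move=> y My x Dx; exact: le_trans (fM x Dx) (ltW My).
Qed.

End bounded_measurable.

Lemma bounded_measurable_restrict d (T : measurableType d) (R : realType)
  (D : set T) (f : T -> R) : measurable D ->
  bounded_measurable D f -> bounded_measurable setT (f \_ D).
Proof.
move=> mD [mf [M fM]]; split; first exact/(measurable_restrictT f mD).
exists `|M| => x _; rewrite patchE; case: ifPn => [/set_mem Dx|_].
  by rewrite (le_trans (fM x Dx))// ler_norm.
by rewrite normr0.
Qed.

Lemma bounded_measurable_comp d d' (T : measurableType d) (U : measurableType d')
  (R : realType) (D : set T) (E : set U) (f : U -> R) (g : T -> U) :
  measurable E -> measurable_fun setT g -> (forall x, D x -> E (g x)) ->
  bounded_measurable E f -> bounded_measurable D (f \o g).
Proof.
move=> mE mg DE [mf [M fM]]; split; last by exists M => x /DE; exact: fM.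
apply: (measurable_comp mE _ mf (measurable_funTS mg)).
by move=> _ [x Dx <-]; exact: DE.
Qed.

Lemma bounded_measurable_prod d1 d2 (T1 : measurableType d1)
    (T2 : measurableType d2) (R : realType) (A : set T1) (B : set T2)
    (f : T1 -> R) (g : T2 -> R) : measurable A -> measurable B ->
  bounded_measurable A f -> bounded_measurable B g ->
  bounded_measurable (A `*` B) (fun z => f z.1 * g z.2).
Proof.
move=> mA mB bf bg; apply: bounded_measurableM.
  by apply: (bounded_measurable_comp mA measurable_fst) bf => z [].
by apply: (bounded_measurable_comp mB measurable_snd) bg => z [].
Qed.

(** * Integrals against finite and signed measures *)

Section finite_measure_integral.
Context d (T : measurableType d) (R : realType) (D : set T).
Hypothesis mD : measurable D.
Implicit Types (f : T -> R) (nu : {finite_measure set T -> \bar R}).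

Lemma EFin_Rintegral nu f : bounded_measurable D f ->
  (\int[nu]_(x in D) f x)%:E = (\int[nu]_(x in D) (f x)%:E)%E.
Proof.
move=> bf; rewrite /Rintegral fineK//; apply: integrable_fin_num => //.
exact: bounded_measurable_integrable.
Qed.

Lemma Rintegral_mscale nu (r : {nonneg R}) f : bounded_measurable D f ->
  \int[mscale r nu]_(x in D) f x = r%:num * \int[nu]_(x in D) f x.
Proof.
move=> bf; have fi := bounded_measurable_integrable nu mD bf.
have [mf _] := (integrableP _ _ _ fi).
apply: EFin_inj; rewrite EFinM !EFin_Rintegral// integralE.
rewrite !ge0_integral_mscale//; [|exact: measurable_funeneg|
  exact: measurable_funepos].
rewrite [X in _ = (_ * X)%E](integralE nu) [RHS]muleBr//.
by rewrite fin_num_adde_defr// integrable_fin_num//; exact: integrable_funepos.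
Qed.

Lemma Rintegral_measure_add nu1 nu2 f : bounded_measurable D f ->
  \int[measure_add nu1 nu2]_(x in D) f x =
  \int[nu1]_(x in D) f x + \int[nu2]_(x in D) f x.
Proof.
move=> bf; rewrite /Rintegral integral_measure_add//.
- by rewrite fineD//; apply: integrable_fin_num => //;
    exact: bounded_measurable_integrable.
- exact: bounded_measurable_integrable.
- exact: bounded_measurable_integrable.
Qed.

(** Moving the negative terms across turns the hypothesis into an equality
between two sums of positive measures, so that the integral against a signed
measure does not depend on how it is split into positive parts. *)
Lemma Rintegral_measure_diff nu1 nu2 nu3 nu4 f : bounded_measurable D f ->
  (forall A, measurable A -> nu1 A - nu2 A = nu3 A - nu4 A)%E ->
  \int[nu1]_(x in D) f x - \int[nu2]_(x in D) f x =
  \int[nu3]_(x in D) f x - \int[nu4]_(x in D) f x.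
Proof.
move=> bf nuE.
suff : \int[measure_add nu1 nu4]_(x in D) f x =
       \int[measure_add nu3 nu2]_(x in D) f x.
  by rewrite !Rintegral_measure_add//; lra.
rewrite /Rintegral; congr fine; apply: eq_measure_integral => A mA _.
rewrite [LHS]measure_addE [RHS]measure_addE; have := nuE _ mA => /=.
rewrite -(fineK (fin_num_measure nu1 _ mA)) -(fineK (fin_num_measure nu2 _ mA)).
rewrite -(fineK (fin_num_measure nu3 _ mA)) -(fineK (fin_num_measure nu4 _ mA)).
by rewrite -!EFinB -!EFinD => -[] ?; congr EFin; lra.
Qed.

End finite_measure_integral.

(** Named so that the sum can carry a structure of finite measure. *)
Section finite_measure_add.
Context d (T : measurableType d) (R : realType).
Variables nu1 nu2 : {finite_measure set T -> \bar R}.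

Definition finite_measure_add : set T -> \bar R := measure_add nu1 nu2.

HB.instance Definition _ := Measure.on finite_measure_add.

Let fin_num_finite_measure_add : fin_num_fun finite_measure_add.
Proof.
by move=> A mA; rewrite /finite_measure_add measure_addE fin_numD !fin_num_measure.
Qed.

HB.instance Definition _ := Measure_isFinite.Build _ _ _ finite_measure_add
  fin_num_finite_measure_add.

End finite_measure_add.

Section charge_integral.
Context d (T : measurableType d) (R : realType).
Implicit Types (lam : {charge set T -> \bar R})
  (P Q : {finite_measure set T -> \bar R}).

(** All that is used of the integral against a signed measure: together with
[Rintegral_measure_diff], it makes the chosen Hahn decomposition irrelevant. *)
Lemma charge_jordanE lam : exists P Q,
  (forall A, measurable A -> lam A = P A - Q A)%E /\
  forall D f, charge_Rintegral lam D f =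
    \int[P]_(x in D) f x - \int[Q]_(x in D) f x.
Proof.
pose h := projT2 (cid (Hahn_pair lam)).
exists (jordan_pos h), (jordan_neg h); split=> [A mA|//].
by rewrite (jordan_decomp h mA) /cadd/= cscaleN1.
Qed.

Context (D : set T).
Hypothesis mD : measurable D.

Lemma charge_Rintegral_diff lam P Q f :
  (forall A, measurable A -> lam A = P A - Q A)%E ->
  bounded_measurable D f ->
  charge_Rintegral lam D f = \int[P]_(x in D) f x - \int[Q]_(x in D) f x.
Proof.
move=> lamE bf; have [P' [Q' [lamE' ->]]] := charge_jordanE lam.
by apply: Rintegral_measure_diff => // A mA; rewrite -lamE// -lamE'.
Qed.

Lemma charge_Rintegral_measure P f : bounded_measurable D f ->
  charge_Rintegral (charge_of_finite_measure P) D f = \int[P]_(x in D) f x.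
Proof.
move=> bf; rewrite (@charge_Rintegral_diff _ P
  (mscale (NngNum (lexx (0 : R))) P))//.
  by rewrite Rintegral_mscale//= mul0r subr0.
by move=> A mA; rewrite /= /mscale/= mul0e sube0.
Qed.

Lemma charge_Rintegral_cadd lam1 lam2 f : bounded_measurable D f ->
  charge_Rintegral (cadd lam1 lam2) D f =
  charge_Rintegral lam1 D f + charge_Rintegral lam2 D f.
Proof.
move=> bf.
have [P1 [Q1 [lamE1 ->]]] := charge_jordanE lam1.
have [P2 [Q2 [lamE2 ->]]] := charge_jordanE lam2.
rewrite (@charge_Rintegral_diff _ (finite_measure_add P1 P2)
  (finite_measure_add Q1 Q2))//.
  by rewrite !Rintegral_measure_add// opprD addrACA.
move=> A mA; rewrite /= /finite_measure_add !measure_addE /cadd/=.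
rewrite lamE1// lamE2//.
by rewrite fin_num_oppeD ?fin_num_measure// addeACA.
Qed.

Lemma charge_Rintegral_cscale (r : R) lam f : bounded_measurable D f ->
  charge_Rintegral (cscale r lam) D f = r * charge_Rintegral lam D f.
Proof.
move=> bf; have [P [Q [lamE ->]]] := charge_jordanE lam.
have [r0|r0] := leP 0 r.
  rewrite (@charge_Rintegral_diff _ (mscale (NngNum r0) P)
    (mscale (NngNum r0) Q))//.
    by rewrite !Rintegral_mscale//= mulrBr.
  move=> A mA; rewrite /= /cscale/= /mscale/= lamE//= muleBr//.
  by rewrite fin_num_adde_defr// fin_num_measure.
(* A negative factor exchanges the two parts. *)
have r1 : 0 <= - r by rewrite oppr_ge0 ltW.
rewrite (@charge_Rintegral_diff _ (mscale (NngNum r1) Q)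
  (mscale (NngNum r1) P))//.
  by rewrite !Rintegral_mscale//=; ring.
move=> A mA; rewrite /= /cscale/= /mscale/= lamE//= EFinN !mulNe oppeK muleBr//.
  by rewrite addeC.
by rewrite fin_num_adde_defr// fin_num_measure.
Qed.

End charge_integral.

(** * Product measures and densities *)

(** The product measure again, named so that it can carry a structure of finite
measure for all finite factors. *)
Section finite_product.
Context d1 d2 (T1 : measurableType d1) (T2 : measurableType d2) (R : realType).
Variables (a : {finite_measure set T1 -> \bar R})
          (b : {finite_measure set T2 -> \bar R}).

Definition finite_product : set (T1 * T2) -> \bar R := (a \x b)%E.

HB.instance Definition _ := Measure.on finite_product.

Let fin_num_finite_product : fin_num_fun finite_product.
Proof.
move=> X mX; rewrite ge0_fin_numE//.
apply: (@le_lt_trans _ _ ((a \x b) setT)%E).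
  by apply: le_measure; rewrite ?inE.
rewrite -setXTT product_measure1E// -ge0_fin_numE ?mule_ge0//.
by rewrite fin_numM ?fin_num_measure.
Qed.

HB.instance Definition _ := Measure_isFinite.Build _ _ _ finite_product
  fin_num_finite_product.

End finite_product.

Section fubini.
Context d1 d2 (T1 : measurableType d1) (T2 : measurableType d2) (R : realType).
Variables (a : {finite_measure set T1 -> \bar R})
          (b : {finite_measure set T2 -> \bar R}) (A : set T1) (B : set T2).
Hypotheses (mA : measurable A) (mB : measurable B).
Local Notation ab := (finite_product a b).

(** Fubini's theorem on a rectangle. The integrand is cut off outside of the
rectangle, which turns every integral into one over the full space. *)
Lemma Rintegral12_prod (h : T1 * T2 -> R) : bounded_measurable (A `*` B) h ->
  \int[ab]_(z in A `*` B) h z = \int[a]_(x in A) \int[b]_(y in B) h (x, y).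
Proof.
move=> bh; have mAB : measurable (A `*` B) by exact: measurableX.
have bh' := bounded_measurable_restrict mAB bh.
have fin1 x : (\int[b]_y ((h \_ (A `*` B)) (x, y))%:E)%E \is a fin_num.
  apply: integrable_fin_num => //.
  apply: (@bounded_measurable_integrable _ _ _ setT
    (fun y => (h \_ (A `*` B)) (x, y))) => //.
  exact: (bounded_measurable_comp measurableT (measurable_pair1 x)).
rewrite Rintegral_mkcond /Rintegral; congr fine.
rewrite -(integral12_prod_meas1 (m1 := a) (m2 := b)
  (f := EFin \o (h \_ (A `*` B)))); last first.
  exact: (@bounded_measurable_integrable _ _ _ _ _ ab).
rewrite [RHS]integral_mkcond; apply: eq_integral => x _.
rewrite /fubini_F patchE; case: ifPn => [/set_mem Ax|/negP nAx]; last first.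
  apply: integral0_eq => y _ /=; rewrite patchE ifN//.
  by apply/negP => /set_mem[/= Ax _]; apply: nAx; exact: mem_set.
rewrite -(fineK (fin1 x)); congr ((fine _)%:E).
rewrite [RHS]integral_mkcond; apply: eq_integral => y _ /=.
rewrite !patchE; case: ifPn => [/set_mem[_ By]|/negP nxy].
  by rewrite ifT// mem_set.
by rewrite ifN//; apply/negP => /set_mem By; apply: nxy; exact: mem_set.
Qed.

Lemma Rintegral21_prod (h : T1 * T2 -> R) : bounded_measurable (A `*` B) h ->
  \int[ab]_(z in A `*` B) h z = \int[b]_(y in B) \int[a]_(x in A) h (x, y).
Proof.
move=> bh; have mAB : measurable (A `*` B) by exact: measurableX.
have bh' := bounded_measurable_restrict mAB bh.
have fin2 y : (\int[a]_x ((h \_ (A `*` B)) (x, y))%:E)%E \is a fin_num.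
  apply: integrable_fin_num => //.
  apply: (@bounded_measurable_integrable _ _ _ setT
    (fun x => (h \_ (A `*` B)) (x, y))) => //.
  exact: (bounded_measurable_comp measurableT (measurable_pair2 y)).
rewrite Rintegral_mkcond /Rintegral; congr fine.
rewrite -(integral21_prod_meas1 (m1 := a) (m2 := b)
  (f := EFin \o (h \_ (A `*` B)))); last first.
  exact: (@bounded_measurable_integrable _ _ _ _ _ ab).
rewrite [RHS]integral_mkcond; apply: eq_integral => y _.
rewrite /fubini_G patchE; case: ifPn => [/set_mem By|/negP nBy]; last first.
  apply: integral0_eq => x _ /=; rewrite patchE ifN//.
  by apply/negP => /set_mem[/= _ By]; apply: nBy; exact: mem_set.
rewrite -(fineK (fin2 y)); congr ((fine _)%:E).
rewrite [RHS]integral_mkcond; apply: eq_integral => x _ /=.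
rewrite !patchE; case: ifPn => [/set_mem[Ax _]|/negP nxy].
  by rewrite ifT// mem_set.
by rewrite ifN//; apply/negP => /set_mem Ax; apply: nxy; exact: mem_set.
Qed.

Lemma Rintegral_prodM (f : T1 -> R) (g : T2 -> R) :
  bounded_measurable A f -> bounded_measurable B g ->
  \int[ab]_(z in A `*` B) (f z.1 * g z.2) =
  (\int[a]_(x in A) f x) * (\int[b]_(y in B) g y).
Proof.
move=> bf bg; rewrite Rintegral12_prod/=; last exact: bounded_measurable_prod.
under eq_Rintegral => x _.
  rewrite RintegralZl//; last exact: bounded_measurable_integrable.
  over.
by rewrite RintegralZr//; exact: bounded_measurable_integrable.
Qed.

End fubini.

Section density.
Context d (T : measurableType d) (R : realType).
Variables (nu mu : {finite_measure set T -> \bar R}) (h : T -> R).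
Hypotheses (bh : bounded_measurable setT h).
Hypothesis nuE : forall A, measurable A ->
  nu A = (\int[mu]_(x in A) (h x)%:E)%E.

(** By uniqueness, h is almost everywhere the Radon-Nikodym derivative of nu,
for which the formula for the change of variables is known. *)
Lemma Rintegral_density D (f : T -> R) : measurable D ->
  bounded_measurable D f ->
  \int[nu]_(x in D) f x = \int[mu]_(x in D) (f x * h x).
Proof.
move=> mD bf; have ih := bounded_measurable_integrable mu measurableT bh.
have numu : nu `<< mu.
  apply/null_content_dominatesP => A mA muA0; rewrite nuE//.
  have mh : measurable_fun A (fun x => (h x)%:E).
    by apply/measurable_EFinP; apply: measurable_funTS; case: bh.
  exact: null_set_integral mA mh muA0.
rewrite /Rintegral; congr fine.
rewrite -(Radon_Nikodym_change_of_variables numu mD); last first.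
  exact: bounded_measurable_integrable.
apply: ae_eq_integral => //.
- apply: emeasurable_funM; last exact: measurable_funTS.
  by apply/measurable_EFinP; case: bf.
- apply/measurable_EFinP/measurable_funM; first by case: bf.
  by case: bh => mh _; exact: measurable_funTS.
- under [X in ae_eq _ _ _ X]eq_fun do rewrite EFinM.
  apply: ae_eqe_mul2l; apply: integral_ae_eq => //.
  + apply: (integrableS measurableT mD) => //.
    exact: (@Radon_Nikodym_integrable _ _ _ (charge_of_finite_measure nu) mu).
  + by apply/measurable_EFinP; case: bh => mh _; exact: measurable_funTS.
  + by move=> A AD mA; rewrite -Radon_Nikodym_integral// -nuE.
Qed.

End density.

(** * Derivatives and primitives of periodic functions *)

Section calculus.
Context (R : realType).
Implicit Types (u v f : R -> R) (p q r x y : R).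
Local Notation leb := (@lebesgue_measure R).
Local Notation I := (unit_itv R).
Local Notation m := (unit_lebesgue R).

Lemma continuous_itv_integrable f p q : continuous f ->
  leb.-integrable `[p, q] (EFin \o f).
Proof.
move=> cf; apply: continuous_compact_integrable; first exact: segment_compact.
exact: continuous_subspaceT.
Qed.

Lemma continuous_subitv_integrable f (A : set (measurableTypeR R)) p q :
  continuous f -> measurable A -> A `<=` `[p, q] ->
  leb.-integrable A (EFin \o f).
Proof.
move=> cf mA Apq.
have mpq : measurable (`[p, q] : set (measurableTypeR R)) by exact: measurable_itv.
apply: (integrableS mpq mA Apq); exact: continuous_itv_integrable.
Qed.

Lemma bounded_measurable_continuous f : continuous f -> bounded_measurable I f.
Proof.
move=> cf; split; first by apply: measurable_funTS; exact: continuous_measurable_fun.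
have /compact_bounded[M [_ fM]] : compact (f @` `[0, 1]).
  apply: continuous_compact; last exact: segment_compact.
  exact: continuous_subspaceT.
exists (`|M| + 1) => x; rewrite /unit_itv/= in_itv/= => /andP[x0 x1].
apply: fM; first by rewrite ltr_pwDr// ler_norm.
by exists x => //=; rewrite in_itv/= x0 ltW.
Qed.

Lemma Rintegral_unit_lebesgue f : \int[m]_(x in I) f x = \int[leb]_(x in I) f x.
Proof.
rewrite /Rintegral; congr fine; apply: eq_measure_integral => A mA AI.
by rewrite /= /unit_lebesgue /mfrestr /mrestr setIidl.
Qed.

Definition continuously_derivable u :=
  (forall x, derivable u x 1) /\ continuous (derive1 u).

Lemma Rintegral_derive1 u p q : continuously_derivable u -> p <= q ->
  \int[leb]_(x in `[p, q]) derive1 u x = u q - u p.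
Proof.
move=> [du cu]; rewrite le_eqVlt => /predU1P[<-|pq].
  by rewrite set_itv1 Rintegral_set1 subrr.
have cu' : continuous u.
  by move=> x; apply/differentiable_continuous/derivable1_diffP.
have uLR : derivable_oo_LRcontinuous u p q.
  by split => //; [exact/cvg_at_right_filter/cu'|exact/cvg_at_left_filter/cu'].
rewrite /Rintegral.
by rewrite (continuous_FTC2 pq (continuous_subspaceT cu) uLR (fun _ _ => erefl)).
Qed.

(** This is how distribution functions enter: the indicator of s <= x,
integrated against the law of s, is the distribution function at x. *)
Lemma Rintegral_derive1_ge u (s : R) : continuously_derivable u -> I s ->
  \int[m]_(x in I) (derive1 u x * (s <= x)%R%:R) = u 1 - u s.
Proof.
move=> du; rewrite /unit_itv/= in_itv/= => /andP[s0 s1].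
rewrite -(Rintegral_derive1 du (ltW s1)) Rintegral_unit_lebesgue.
rewrite -Rintegral_itv_bndo_bndc; last first.
  apply: (@continuous_subitv_integrable _ _ s 1); [by case: du|by []|].
  by apply: subset_itvl; rewrite bnd_simp.
rewrite [LHS]Rintegral_mkcond [RHS]Rintegral_mkcond; apply: eq_Rintegral => x _.
rewrite !patchE !mem_setE /unit_itv !in_itv/=.
have [sx|xs] := leP s x; first by rewrite (le_trans s0 sx) mulr1.
by rewrite mulr0; case: ifP.
Qed.

Lemma Rintegral_derive1_periodic u : continuously_derivable u ->
  periodic u 1 -> \int[m]_(x in I) derive1 u x = 0.
Proof.
move=> du pu; have I0 : I 0 by rewrite /unit_itv/= in_itv/= lexx ltr01.
have := Rintegral_derive1_ge du I0; rewrite -[X in u X](add0r 1) pu subrr => <-.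
apply: eq_Rintegral => x /set_mem; rewrite /unit_itv/= in_itv/= => /andP[-> _].
by rewrite mulr1.
Qed.

Lemma Rintegral_itv_chasles f p q r : continuous f -> p <= q -> q <= r ->
  \int[leb]_(x in `[p, r]) f x =
  \int[leb]_(x in `[p, q]) f x + \int[leb]_(x in `[q, r]) f x.
Proof.
move=> cf pq qr; apply/eqP; rewrite -subr_eq addrC addrC -subr_eq0.
have intf := continuous_itv_integrable p r cf.
have := @Rintegral_itvB R f (BLeft p) (BRight r) q intf.
rewrite !bnd_simp => /(_ pq qr).
rewrite Rintegral_itv_obnd_cbnd; last first.
  by apply: (@continuous_subitv_integrable _ _ q r) => //;
    apply: subset_itvr; rewrite bnd_simp.
by move=> <-; rewrite -subr_eq0; apply/eqP; ring.
Qed.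

Lemma Rintegral_itv_ge f p q : q <= p -> \int[leb]_(x in `[p, q]) f x = 0.
Proof.
rewrite le_eqVlt => /predU1P[->|qp]; first by rewrite set_itv1 Rintegral_set1.
by rewrite set_itv_ge ?Rintegral_set0// bnd_simp -ltNge.
Qed.

(** The oriented integral of f from 0 to x; one of the two terms vanishes. *)
Definition primitive f x :=
  \int[leb]_(t in `[0, x]) f t - \int[leb]_(t in `[x, 0]) f t.

Lemma primitiveE f p x : continuous f -> p <= 0 -> p <= x ->
  primitive f x = \int[leb]_(t in `[p, x]) f t - \int[leb]_(t in `[p, 0]) f t.
Proof.
move=> cf p0 px; rewrite /primitive; have [x0|/ltW x0] := leP 0 x.
  by rewrite (Rintegral_itv_chasles cf p0 x0) (Rintegral_itv_ge f x0); ring.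
by rewrite (Rintegral_itv_chasles cf px x0) (Rintegral_itv_ge f x0); ring.
Qed.

Lemma is_derive_primitive f x : continuous f ->
  is_derive x 1 (primitive f) (f x).
Proof.
move=> cf; pose p := Num.min 0 x - 1.
have p0 : p < 0 by rewrite ltrBlDr add0r gt_min ltr01.
have px : p < x by rewrite ltrBlDr gt_min ltrDl ltr01 orbT.
have x1 : x < x + 1 by rewrite ltrDl.
have [dF F'] := continuous_FTC1_closed x1
  (continuous_itv_integrable p (x + 1) cf) px (cf x).
have dI : is_derive x 1 (fun y => \int[leb]_(t in `[p, y]) f t) (f x).
  by apply: DeriveDef; [exact: dF|rewrite -derive1E; exact: F'].
have : is_derive x 1 (fun y => \int[leb]_(t in `[p, y]) f t -
    \int[leb]_(t in `[p, 0]) f t) (f x - 0).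
  exact: is_deriveB dI (is_derive_cst _ _ _).
rewrite subr0; apply: near_eq_is_derive.
near=> y; rewrite (@primitiveE f p)// ltW//.
by near: y; exact: lt_nbhsr.
Unshelve. all: by end_near. Qed.

(** The increment of the primitive over a period is constant, since its
derivative f (x + 1) - f x vanishes, and it is the mean of f. *)
Lemma periodic_primitive f : continuous f -> periodic f 1 ->
  \int[m]_(x in I) f x = 0 ->
  periodic_C1 (primitive f) /\ derive1 (primitive f) = f.
Proof.
move=> cf pf f0.
have dF x := @is_derive_primitive f x cf.
have F'E : derive1 (primitive f) = f by apply/funext => x; rewrite derive1E derive_val.
split=> //; split; rewrite ?F'E//.
have dG x : is_derive x 1 (fun x => primitive f (x + 1) - primitive f x) 0.
  rewrite -(subrr (f x)) -[X in _ (X - _)]pf; apply: is_deriveB.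
  rewrite -[X in is_derive _ _ _ X]mulr1; apply: is_derive1_comp.
  by rewrite -[X in is_derive _ _ _ X]addr0; exact: is_deriveD.
move=> x; apply/eqP; rewrite -subr_eq0; apply/eqP.
have /= -> := is_derive_0_is_cst x 0 dG.
rewrite add0r /primitive (Rintegral_itv_ge f ler01) !set_itv1 !Rintegral_set1.
rewrite !subr0 -[RHS]f0 Rintegral_unit_lebesgue Rintegral_itv_bndo_bndc//.
by apply: (@continuous_subitv_integrable _ _ 0 1) => //;
  apply: subset_itvl; rewrite bnd_simp.
Qed.

End calculus.

(** * Hoeffding's formula *)

Section hoeffding_covariance.
Context (R : realType) (mu : probability (measurableTypeR R) R).
Hypothesis hmu : carried_by (unit_itv R) mu.
Local Notation leb := (@lebesgue_measure R).
Local Notation I := (unit_itv R).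
Local Notation sq := (unit_square R).
Local Notation m := (unit_lebesgue R).
Local Notation mm := (finite_product m m).
Local Notation F := (distribution_function mu).
Local Notation RR := (measurableTypeR R * measurableTypeR R)%type.
Implicit Types (u v : R -> R) (s x y : R).
Let mI := @measurable_unit_itv R.
Let msq := @measurable_unit_square R.

Lemma carried_by_unit_itv1 : mu I = 1%E.
Proof. by rewrite -[I]setTI -hmu// probability_setT. Qed.

Lemma distribution_functionE x : F x = \int[mu]_(s in I) (s <= x)%R%:R.
Proof.
have mx : measurable (`]-oo, x] : set (measurableTypeR R)).
  exact: measurable_itv.
rewrite /distribution_function (hmu mx) -integral_indic// /Rintegral.
congr fine; apply: eq_integral => s _ /=.
by rewrite indicE mem_setE in_itv.
Qed.

Lemma bounded_measurable_le D : bounded_measurable D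
  (fun z : RR => (z.1 <= z.2)%R%:R : R).
Proof.
have mle : measurable
    [set z : RR | (z.1 <= z.2 :> R)%R].
  rewrite -[X in measurable X]setTI; 
  exact: (@measurable_fun_le _ _ R setT (@fst R R) (@snd R R) measurableT
    measurable_fst measurable_snd).
have := bounded_measurable_indic R D mle.
congr bounded_measurable; apply/funext => z; rewrite indicE; congr ((nat_of_bool _)%:R).
by apply/idP/idP; rewrite inE.
Qed.

Lemma bounded_measurable_hoeffding_density D :
  bounded_measurable D (hoeffding_density mu : RR -> R).
Proof.
split; first by apply: measurable_funTS; exact: measurable_hoeffding_density.
exists 1 => z _; rewrite ger0_norm ?hoeffding_density_ge0//.
exact: hoeffding_density_le1.
Qed.

Lemma bounded_measurable_derive1 u : continuously_derivable u ->
  bounded_measurable I (derive1 u).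
Proof. by move=> [_ cu]; exact: bounded_measurable_continuous. Qed.

Lemma bounded_measurable_derivable u : continuously_derivable u ->
  bounded_measurable I u.
Proof.
move=> [du _]; apply: bounded_measurable_continuous => x.
exact/differentiable_continuous/derivable1_diffP.
Qed.

Let bounded_measurable_tail u : bounded_measurable I u ->
  bounded_measurable (I `*` I)
    (fun z : measurableTypeR R * measurableTypeR R =>
      u z.2 * (z.1 <= z.2)%R%:R).
Proof.
move=> bu; apply: bounded_measurableM.
  by apply: (bounded_measurable_comp mI measurable_snd) bu => z [].
exact: bounded_measurable_le.
Qed.

Let bounded_measurable_ge s : bounded_measurable I (fun x => (s <= x)%R%:R : R).
Proof.
exact: (bounded_measurable_comp measurableT (measurable_pair1 s))
  (bounded_measurable_le setT).
Qed.

Let bounded_measurable_le1 x : bounded_measurable I (fun s => (s <= x)%R%:R : R).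
Proof.
exact: (bounded_measurable_comp measurableT (measurable_pair2 x))
  (bounded_measurable_le setT).
Qed.

(** Write F x as the integral of the indicator of s <= x, exchange the two
integrals, and integrate the derivative of u from s to 1. *)
Lemma Rintegral_derive1_distribution u : continuously_derivable u ->
  \int[m]_(x in I) (derive1 u x * F x) = \int[mu]_(s in I) (u 1 - u s).
Proof.
move=> du; have bh := bounded_measurable_tail (bounded_measurable_derive1 du).
transitivity (\int[finite_product mu m]_(z in I `*` I)
    (derive1 u z.2 * (z.1 <= z.2)%R%:R)).
  rewrite Rintegral21_prod//=; apply: eq_Rintegral => x _.
  rewrite distribution_functionE -RintegralZl//.
  exact: bounded_measurable_integrable.
rewrite Rintegral12_prod//=; apply: eq_Rintegral => s /set_mem Is.
exact: Rintegral_derive1_ge.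
Qed.

(** The same computation in two variables: s <= min x y exactly when s <= x and
s <= y, so that for a fixed s the double integral is a product. *)
Lemma Rintegral_derive1_distribution_min u v :
  continuously_derivable u -> continuously_derivable v ->
  \int[mm]_(z in sq) (derive1 u z.1 * derive1 v z.2 * F (Num.min z.1 z.2)) =
  \int[mu]_(s in I) ((u 1 - u s) * (v 1 - v s)).
Proof.
move=> du dv; have bu := bounded_measurable_tail (bounded_measurable_derive1 du).
have bv := bounded_measurable_tail (bounded_measurable_derive1 dv).
pose h (z : measurableTypeR R * (measurableTypeR R * measurableTypeR R)) :=
  (derive1 u z.2.1 * (z.1 <= z.2.1)%R%:R) *
  (derive1 v z.2.2 * (z.1 <= z.2.2)%R%:R).
have mII : measurable (I `*` I) by exact: measurableX.
have bh : bounded_measurable (I `*` sq) h.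
  apply: bounded_measurableM.
    apply: (bounded_measurable_comp (g := fun z => (z.1, z.2.1)) mII) bu.
      apply: measurable_fun_pair; first exact: measurable_fst.
      exact: (measurableT_comp measurable_fst measurable_snd).
    by move=> [s [x y]] [/= Is [Ix Iy]].
  apply: (bounded_measurable_comp (g := fun z => (z.1, z.2.2)) mII) bv.
    apply: measurable_fun_pair; first exact: measurable_fst.
    exact: (measurableT_comp measurable_snd measurable_snd).
  by move=> [s [x y]] [/= Is [Ix Iy]].
transitivity (\int[finite_product mu mm]_(z in I `*` sq) h z).
  rewrite [RHS]Rintegral21_prod//=; apply: eq_Rintegral => -[x y] _.
  rewrite distribution_functionE -RintegralZl//=; last first.
    exact: bounded_measurable_integrable.
  apply: eq_Rintegral => s _; rewrite /h/= le_min mulrACA -natrM mulnb.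
  by congr (_ * _).
rewrite Rintegral12_prod//=; apply: eq_Rintegral => s /set_mem Is.
rewrite /h/= (Rintegral_prodM _ _ mI mI (f := fun x => derive1 u x * (s <= x)%R%:R)
  (g := fun x => derive1 v x * (s <= x)%R%:R)).
- by rewrite !Rintegral_derive1_ge.
- by apply: bounded_measurableM => //; exact: bounded_measurable_derive1.
- by apply: bounded_measurableM => //; exact: bounded_measurable_derive1.
Qed.

Lemma unit_lebesgue_productE (X : set RR) :
  measurable X -> mm X = (leb \x leb)%E (X `&` sq).
Proof.
move=> mX; rewrite /finite_product.
rewrite (product_measure_unique (m' := mrestr (leb \x leb)%E msq))//.
move=> A B mA mB; rewrite /= /mrestr /unit_square -setXI product_measure1E//.
- exact: measurableI.
- exact: measurableI.
Qed.

(** Lebesgue measure of the plane is not finite; restricted to the square it is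
the square of the uniform probability, and Fubini applies. *)
Lemma hoeffdingE A : measurable A ->
  hoeffding mu A = (\int[mm]_(z in A) (hoeffding_density mu z)%:E)%E.
Proof.
move=> mA; have mAsq : measurable (A `&` sq) by exact: measurableI.
have mN : measurable (~` sq) by exact: measurableC.
have mN0 : mm (~` sq) = 0%E by rewrite unit_lebesgue_productE// setICl measure0.
have iH : mm.-integrable A (EFin \o hoeffding_density mu).
  apply: bounded_measurable_integrable => //.
  exact: bounded_measurable_hoeffding_density.
rewrite (negligible_integral mN mA iH mN0).
rewrite setDE setCK /hoeffding; apply: eq_measure_integral => B mB Bsq.
rewrite [RHS]unit_lebesgue_productE// setIidl//.
by apply: (subset_trans Bsq) => z [].
Qed.

(** Hoeffding's formula. The functions are not assumed to be periodic, because
the case of two identities computes the variance. Since {min x y, max x y} =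
{x, y}, the density is F (min x y) - F x F y; the two preceding computations
turn these terms into the two terms of the covariance of u 1 - u and v 1 - v,
and a covariance ignores constants and a common change of sign. *)
Lemma Rintegral_hoeffding u v :
  continuously_derivable u -> continuously_derivable v ->
  \int[hoeffding mu]_(z in sq) (derive1 u z.1 * derive1 v z.2) =
  \int[mu]_(x in I) (u x * v x) -
  (\int[mu]_(x in I) u x) * (\int[mu]_(x in I) v x).
Proof.
move=> du dv.
have bu' := bounded_measurable_derive1 du.
have bv' := bounded_measurable_derive1 dv.
have bF : bounded_measurable I F.
  split; first by apply: measurable_funTS; exact: measurable_distribution_function.
  exists 1 => x _; rewrite ger0_norm ?distribution_function_ge0//.
  exact: distribution_function_le1.
have bmin : bounded_measurable sq
    (fun z : RR => F (Num.min z.1 z.2)).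
  split.
    apply: measurable_funTS.
    apply: (measurableT_comp (@measurable_distribution_function R mu)).
    by apply: measurable_minr; [exact: measurable_fst|exact: measurable_snd].
  exists 1 => x _; rewrite ger0_norm ?distribution_function_ge0//.
  exact: distribution_function_le1.
have bH := bounded_measurable_hoeffding_density setT.
have buv' := bounded_measurable_prod mI mI bu' bv'.
rewrite (Rintegral_density bH hoeffdingE msq buv').
have HE (z : R * R) : derive1 u z.1 * derive1 v z.2 * hoeffding_density mu z =
    derive1 u z.1 * derive1 v z.2 * F (Num.min z.1 z.2) -
    (derive1 u z.1 * F z.1) * (derive1 v z.2 * F z.2).
  by rewrite /hoeffding_density; case: leP => _; ring.
under eq_Rintegral do rewrite HE.
have bmM f : bounded_measurable I f -> bounded_measurable I (fun x => f x * F x).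
  by move=> bf; exact: bounded_measurableM.
rewrite RintegralB//; last 2 first.
- apply: bounded_measurable_integrable => //.
  by apply: bounded_measurableM => //; exact: bounded_measurable_prod.
- apply: bounded_measurable_integrable => //.
  exact: (bounded_measurable_prod mI mI (bmM _ bu') (bmM _ bv')).
rewrite Rintegral_derive1_distribution_min//.
rewrite (Rintegral_prodM _ _ mI mI (bmM _ bu') (bmM _ bv')).
rewrite !Rintegral_derive1_distribution//.
have bu := bounded_measurable_derivable du.
have bv := bounded_measurable_derivable dv.
have intI f : bounded_measurable I f -> mu.-integrable I (EFin \o f).
  exact: bounded_measurable_integrable.
have cstE (r : R) : \int[mu]_(x in I) r = r.
  rewrite Rintegral_cst// -[RHS]mulr1; congr (_ * _).
  have /(congr1 fine) e := carried_by_unit_itv1; exact: e.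
have bcst (r : R) := bounded_measurable_cst I r.
rewrite !RintegralB ?cstE//; try exact: intI.
have -> : \int[mu]_(s in I) ((u 1 - u s) * (v 1 - v s)) =
    \int[mu]_(s in I) (u 1 * v 1 - u 1 * v s - (v 1 * u s - u s * v s)).
  by apply: eq_Rintegral => s _; ring.
have buv : bounded_measurable I (fun x => u x * v x) by exact: bounded_measurableM.
have bZ (r : R) f : bounded_measurable I f -> bounded_measurable I (fun x => r * f x).
  by move=> bf; exact: bounded_measurableM.
rewrite RintegralB//; [|by apply: intI; apply: bounded_measurableB => //; exact: bZ..].
rewrite !RintegralB//; try by apply: intI => //; exact: bZ.
rewrite !RintegralZl ?cstE//; try exact: intI.
by ring.
Qed.

End hoeffding_covariance.

(** * Limits of integrals and generators of product spaces *)

(** An integral of f \o phi only depends on the image measure by phi. *)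
Lemma Rintegral_comp_eq d d' (T : measurableType d) (U : measurableType d')
    (R : realType) (P Q : {finite_measure set T -> \bar R}) (phi : T -> U)
    (f : U -> R) :
  measurable_fun setT phi -> bounded_measurable setT f ->
  (forall A, measurable A -> P (phi @^-1` A) = Q (phi @^-1` A)) ->
  \int[P]_x f (phi x) = \int[Q]_x f (phi x).
Proof.
move=> mphi bf PQ; rewrite /Rintegral; congr fine.
have iP (nu : {finite_measure set T -> \bar R}) :
    nu.-integrable (phi @^-1` setT) ((EFin \o f) \o phi).
  rewrite preimage_setT.
  apply: (@bounded_measurable_integrable _ _ _ _ (f \o phi)) => //.
  exact: (bounded_measurable_comp measurableT mphi (fun _ _ => Logic.I) bf).
have mf : measurable_fun setT (EFin \o f) by apply/measurable_EFinP; case: bf.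
rewrite -(integral_pushforward mphi mf (iP P) measurableT).
rewrite -(integral_pushforward mphi mf (iP Q) measurableT).
apply: eq_measure_integral => A mA _; exact: PQ.
Qed.

(** The cylinders over the sets of G1 and G2 generate the product; they are
themselves rectangles of the family because setT belongs to G1 and G2. *)
Lemma measurable_prod_generated d1 d2 (T1 : measurableType d1)
    (T2 : measurableType d2) (G1 : set (set T1)) (G2 : set (set T2)) :
  measurable = <<s G1 >> -> measurable = <<s G2 >> -> G1 setT -> G2 setT ->
  @measurable _ (T1 * T2)%type = <<s [set A `*` B | A in G1 & B in G2] >>.
Proof.
move=> mG1 mG2 G1T G2T; set G := [set _ | _ in _ & _ in _].
rewrite eqEsubset; split; last first.
  apply: smallest_sub; first exact: sigma_algebra_measurable.
  move=> _ [A G1A [B G2B <-]]; apply: measurableX.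
    by rewrite mG1; exact: sub_sigma_algebra.
  by rewrite mG2; exact: sub_sigma_algebra.
have sG := smallest_sigma_algebra setT G.
apply: smallest_sub => // X [|] [A mA <-]; rewrite setTI.
  have : <<s G1 >> A by rewrite -mG1.
  move: A {mA}; apply: smallest_sub.
    have := @sigma_algebra_image _ _ setT (@fst T1 T2) <<s G >> sG.
    by congr sigma_algebra; apply/seteqP; split => B; rewrite /image_set_system/= setTI.
  move=> A G1A; apply: sub_sigma_algebra; exists A => //; exists setT => //.
  by apply/seteqP; split=> [z []|].
have : <<s G2 >> A by rewrite -mG2.
move: A {mA}; apply: smallest_sub.
  have := @sigma_algebra_image _ _ setT (@snd T1 T2) <<s G >> sG.
  by congr sigma_algebra; apply/seteqP; split => B; rewrite /image_set_system/= setTI.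
move=> A G2A; apply: sub_sigma_algebra; exists setT => //; exists A => //.
by apply/seteqP; split=> [z []|].
Qed.

Lemma Rintegral_dominated_cvg d (T : measurableType d) (R : realType)
    (nu : {finite_measure set T -> \bar R}) (D : set T)
    (f_ : nat -> T -> R) (f : T -> R) : measurable D ->
  (forall n, measurable_fun D (f_ n)) -> measurable_fun D f ->
  (forall n x, D x -> `|f_ n x| <= 1) ->
  (forall x, D x -> f_ n x @[n --> \oo] --> f x) ->
  \int[nu]_(x in D) f_ n x @[n --> \oo] --> \int[nu]_(x in D) f x.
Proof.
move=> mD mf_ mf f_1 f_f.
have i1 : nu.-integrable D (EFin \o cst (1 : R)).
  by apply: bounded_measurable_integrable => //; exact: bounded_measurable_cst.
have mEf_ n : measurable_fun D (EFin \o f_ n) by exact/measurable_EFinP.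
have mEf : measurable_fun D (EFin \o f) by exact/measurable_EFinP.
have Ef_f : {ae nu, forall x, D x ->
    (EFin \o f_ n) x @[n --> \oo] --> (EFin \o f) x}.
  apply: aeW => x Dx; apply/fine_cvgP; split; last exact: f_f.
  exact: nearW.
have Ef_1 : {ae nu, forall x n, D x ->
    (`|(EFin \o f_ n) x| <= (EFin \o cst (1 : R)%R) x)%E}.
  by apply: aeW => x n Dx; rewrite lee_fin; exact: f_1.
have [intf _] := dominated_convergence mD mEf_ mEf Ef_f i1 Ef_1.
by rewrite -(fineK (integrable_fin_num mD intf)) => /fine_cvg.
Qed.

Section ramp.
Context (R : realType).
Implicit Types (f : R -> R).

(** An approximation of the indicator of the set where f is positive that
inherits continuity and periodicity from f. *)
Definition ramp f (n : nat) x : R := Num.min 1 (n%:R * Num.max 0 (f x)).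

Lemma continuous_ramp f n : continuous f -> continuous (ramp f n).
Proof.
move=> cf x; apply: (@continuous_min R R (cst 1) (fun y => n%:R * Num.max 0 (f y)) x).
  exact: cvg_cst.
apply: cvgM; first exact: cvg_cst.
apply: (@continuous_max R R (cst 0) f x); [exact: cvg_cst|exact: cf].
Qed.

Lemma periodic_ramp f n : periodic f 1 -> periodic (ramp f n) 1.
Proof. by move=> pf x; rewrite /ramp pf. Qed.

Lemma ramp_ge0 f n x : 0 <= ramp f n x.
Proof. by rewrite le_min ler01 mulr_ge0// le_max lexx. Qed.

Lemma ramp_le1 f n x : ramp f n x <= 1.
Proof. by rewrite ge_min lexx. Qed.

Lemma cvg_ramp f x : ramp f n x @[n --> \oo] --> ((0 < f x)%R%:R : R).
Proof.
have [f0|f0] := ltP 0 (f x); last first.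
  apply: cvg_near_cst; apply: nearW => n.
  by rewrite /ramp max_l// mulr0 min_r.
apply: cvg_near_cst; near=> n; rewrite /ramp max_r ?(ltW f0)// min_l//.
rewrite -ler_pdivrMr// mul1r; near: n; exact: nbhs_infty_ger.
Unshelve. all: by end_near. Qed.

End ramp.

Section null_setC.
Context d (T : measurableType d) (R : realType).
Variables (nu : {finite_measure set T -> \bar R}) (D : set T).
Hypotheses (mD : measurable D) (nuD : nu (~` D) = 0%E).

Lemma Rintegral_null_setC (h : T -> R) : bounded_measurable setT h ->
  \int[nu]_x h x = \int[nu]_(x in D) h x.
Proof.
move=> bh; rewrite /Rintegral; congr fine.
have ih := bounded_measurable_integrable nu measurableT bh.
have mDc : measurable (~` D) by exact: measurableC.
by rewrite (negligible_integral mDc measurableT ih nuD) setTD setCK.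
Qed.

Lemma EFin_Rintegral_indic (A : set T) : measurable A ->
  (\int[nu]_(x in D) \1_A x)%:E = nu A.
Proof.
move=> mA; have bA := bounded_measurable_indic R setT mA.
rewrite -(Rintegral_null_setC bA) EFin_Rintegral// integral_indic// setIT//.
Qed.

End null_setC.

(** * Sets cut out by continuous periodic functions *)

Section circle_sets.
Context (R : realType).
Local Notation I := (unit_itv R).
Implicit Types f g : R -> R.

Definition continuous_periodic f := continuous f /\ periodic f 1.

(** The traces on [0, 1[ of these sets are those of the cozero sets of the
circle; outside of [0, 1[ the sets are arbitrary, so that they generate all the
Borel sets of the line. *)
Definition circle_set : set (set (measurableTypeR R)) :=
  [set A | measurable A /\ exists2 f, continuous_periodic f &
    forall x, I x -> (x \in A) = (0 < f x)].

Lemma setI_closed_circle_set : setI_closed circle_set.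
Proof.
move=> A B [mA [f [cf pf] fA]] [mB [g [cg pg] gB]].
split; first exact: measurableI.
exists (f \min g); last by move=> x Ix /=; rewrite in_setI fA// gB// lt_min.
split; last by move=> x /=; rewrite pf pg.
by move=> x; apply: (@continuous_min R R f g x); [exact: cf|exact: cg].
Qed.

Lemma circle_setT : circle_set setT.
Proof.
split=> //; exists (cst 1) => [|x _]; last by rewrite /= ltr01 in_setT.
by split=> [x|//]; exact: cvg_cst.
Qed.

Lemma sin_pi_gt0 (x : R) : 0 < x < 1 -> 0 < sin (pi * x).
Proof.
move=> /andP[x0 x1]; apply: sin_gt0_pi.
by rewrite mulr_gt0 ?pi_gt0//= gtr_pMr ?pi_gt0.
Qed.

Lemma sin_pi_le0 (x : R) : -1 < x <= 0 -> sin (pi * x) <= 0.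
Proof.
move=> /andP[x1]; rewrite le_eqVlt => /predU1P[->|x0].
  by rewrite mulr0 sin0.
rewrite -oppr_ge0 -sinN -mulrN ltW// sin_pi_gt0// oppr_gt0 x0 /=; lra.
Qed.

(** Rays generate the Borel sets; their traces on [0, 1[ are arcs. *)
Lemma circle_set_ray (a : R) : circle_set `]a, +oo[.
Proof.
split; first exact: measurable_itv.
have [a0|a0] := ltP a 0.
  exists (cst 1) => [|x]; first by split=> [x|//]; exact: cvg_cst.
  rewrite /unit_itv/= in_itv/= => /andP[x0 _].
  by rewrite ltr01 mem_setE in_itv/= andbT (lt_le_trans a0 x0).
have [a1|a1] := leP 1 a.
  exists (cst 0) => [|x]; first by split=> [x|//]; exact: cvg_cst.
  rewrite /unit_itv/= in_itv/= => /andP[_ x1].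
  by rewrite ltxx mem_setE in_itv/= andbT; apply/negbTE; rewrite -leNgt; lra.
(* Each factor changes sign under x |-> x + 1, hence the product is periodic;
   on ]0, 1[ the second factor is positive and the first has the sign of
   x - a. *)
exists (fun x => sin (pi * (x - a)) * sin (pi * x)).
  split=> [x|x].
    apply: cvgM.
      apply: (@continuous_comp R R R (fun x => pi * (x - a)) sin);
        last exact: continuous_sin.
      by apply: cvgM; [exact: cvg_cst|apply: cvgB; [exact: cvg_id|exact: cvg_cst]].
    apply: (@continuous_comp R R R (fun x => pi * x) sin);
      last exact: continuous_sin.
    by apply: cvgM; [exact: cvg_cst|exact: cvg_id].
  rewrite (_ : pi * (x + 1 - a) = pi * (x - a) + pi); last by ring.
  by rewrite (_ : pi * (x + 1) = pi * x + pi) ?sinDpi ?mulrNN//; ring.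
move=> x; rewrite /unit_itv/= in_itv/= => /andP[x0 x1].
rewrite mem_setE in_itv/= andbT; have [ax|xa] := ltP a x.
  by rewrite mulr_gt0// sin_pi_gt0//; lra.
apply/esym/negbTE; rewrite -leNgt mulr_le0_ge0//.
  by rewrite sin_pi_le0//; lra.
move: x0; rewrite le_eqVlt => /predU1P[<-|x0]; first by rewrite mulr0 sin0.
by rewrite ltW// sin_pi_gt0// x0.
Qed.

Lemma measurable_circle_set : measurable = <<s circle_set >>.
Proof.
rewrite eqEsubset; split; last first.
  apply: smallest_sub; first exact: sigma_algebra_measurable.
  by move=> A [].
rewrite [X in X `<=` _]RGenOInfty.measurableE.
apply: smallest_sub; first exact: smallest_sigma_algebra.
by move=> _ [a ->]; apply: sub_sigma_algebra; exact: circle_set_ray.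
Qed.

End circle_sets.

(** * Uniqueness *)

Section uniqueness.
Context (R : realType).
Local Notation I := (unit_itv R).
Local Notation sq := (unit_square R).
Local Notation m := (unit_lebesgue R).
Local Notation RR := (measurableTypeR R * measurableTypeR R)%type.
Variables P Q : {finite_measure set RR -> \bar R}.
Hypotheses (Psq : P (~` sq) = 0%E) (Qsq : Q (~` sq) = 0%E).
Hypothesis PQfst : forall A : set (measurableTypeR R), measurable A ->
  P (fst @^-1` A) = Q (fst @^-1` A).
Hypothesis PQsnd : forall A : set (measurableTypeR R), measurable A ->
  P (snd @^-1` A) = Q (snd @^-1` A).
Hypothesis PQint : forall u v : R -> R, periodic_C1 u -> periodic_C1 v ->
  \int[P]_(z in sq) (derive1 u z.1 * derive1 v z.2) =
  \int[Q]_(z in sq) (derive1 u z.1 * derive1 v z.2).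
Let mI := @measurable_unit_itv R.
Let msq := @measurable_unit_square R.
Implicit Types (f g : R -> R).

Let same_integral (h : RR -> R) := bounded_measurable sq h /\
  \int[P]_(z in sq) h z = \int[Q]_(z in sq) h z.

Let same_integralD h1 h2 : same_integral h1 -> same_integral h2 ->
  same_integral (fun z => h1 z + h2 z).
Proof.
move=> [b1 e1] [b2 e2]; split; first exact: bounded_measurableD.
by rewrite !RintegralD ?e1 ?e2//; exact: bounded_measurable_integrable.
Qed.

Let same_integralZ (r : R) h : same_integral h -> same_integral (fun z => r * h z).
Proof.
move=> [b e]; split.
  by apply: bounded_measurableM => //; exact: bounded_measurable_cst.
by rewrite !RintegralZl ?e//; exact: bounded_measurable_integrable.
Qed.

Let same_integral_coord (phi : RR -> measurableTypeR R) f :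
  measurable_fun setT phi -> (forall z, sq z -> I (phi z)) ->
  (forall A, measurable A -> P (phi @^-1` A) = Q (phi @^-1` A)) ->
  bounded_measurable I f -> same_integral (f \o phi).
Proof.
move=> mphi phiI PQphi bf; split; first exact: bounded_measurable_comp mI _ _ bf.
have bfI := bounded_measurable_restrict mI bf.
have bfphi : bounded_measurable setT (fun z => (f \_ I) (phi z)).
  exact: (bounded_measurable_comp measurableT mphi (fun _ _ => Logic.I) bfI).
have E (nu : {finite_measure set RR -> \bar R}) : nu (~` sq) = 0%E ->
    \int[nu]_(z in sq) (f \o phi) z = \int[nu]_z (f \_ I) (phi z).
  move=> nusq; rewrite (Rintegral_null_setC msq nusq bfphi).
  by apply: eq_Rintegral => z /set_mem/phiI Iz; rewrite patchE mem_set.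
by rewrite !E//; exact: Rintegral_comp_eq.
Qed.

(** Continuous periodic functions are constants plus derivatives, and the
constants only see the marginals. *)
Let same_integral_continuous f g :
  continuous_periodic f -> continuous_periodic g ->
  same_integral (fun z => f z.1 * g z.2).
Proof.
move=> [cf pf] [cg pg].
pose mean (f : R -> R) := \int[m]_(x in I) f x.
have bc (h : R -> R) : continuous h -> bounded_measurable I h.
  exact: bounded_measurable_continuous.
have centered (h : R -> R) : continuous h -> periodic h 1 -> exists2 u, periodic_C1 u &
    derive1 u = (fun x => h x - mean h).
  move=> ch ph.
  have ch0 : continuous (fun x => h x - mean h).
    by move=> x; apply: cvgB; [exact: ch|exact: cvg_cst].
  have ph0 : periodic (fun x => h x - mean h) 1 by move=> x; rewrite ph.
  have h0 : \int[m]_(x in I) (h x - mean h) = 0.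
    rewrite RintegralB//.
    - rewrite Rintegral_cst// /= /unit_lebesgue /mfrestr /mrestr setIid.
      by rewrite lebesgue_measure_unit_itv mulr1 subrr.
    - exact: (bounded_measurable_integrable _ mI (bc _ ch)).
    - exact: (bounded_measurable_integrable _ mI (bounded_measurable_cst _ _)).
  have [pu uE] := periodic_primitive ch0 ph0 h0.
  by exists (primitive (fun x => h x - mean h)).
have [u pu uE] := centered f cf pf.
have [v pv vE] := centered g cg pg.
have s0 : same_integral (fun z => (f z.1 - mean f) * (g z.2 - mean g)).
  have bd (h : R -> R) (r : R) : continuous h -> bounded_measurable I (fun x => h x - r).
    move=> ch; apply: bounded_measurableB; first exact: bc.
    exact: bounded_measurable_cst.
  split; first exact: (bounded_measurable_prod mI mI (bd _ _ cf) (bd _ _ cg)).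
  by have := PQint pu pv; rewrite uE vE.
have fstI z : sq z -> I z.1 by case.
have sndI z : sq z -> I z.2 by case.
have s1 : same_integral (f \o fst).
  exact: (same_integral_coord measurable_fst fstI PQfst (bc _ cf)).
have s2 : same_integral (g \o snd).
  exact: (same_integral_coord measurable_snd sndI PQsnd (bc _ cg)).
have s3 : same_integral (cst (- (mean f * mean g)) \o fst).
  apply: (same_integral_coord measurable_fst fstI PQfst).
  exact: bounded_measurable_cst.
(* f g = (f - a) (g - b) + a g + b f - a b, where a and b are the means. *)
have := same_integralD s0 (same_integralD (same_integralZ (mean f) s2)
  (same_integralD (same_integralZ (mean g) s1) s3)).
by congr same_integral; apply/funext => z /=; ring.
Qed.

(** The indicator of a rectangle is a bounded limit of products of continuous
periodic functions. *)
Let same_rectangle A B : circle_set A -> circle_set B -> P (A `*` B) = Q (A `*` B).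
Proof.
move=> [mA [f cpf fA]] [mB [g cpg gB]].
have mAB : measurable (A `*` B) by exact: measurableX.
rewrite -(EFin_Rintegral_indic msq Psq mAB) -(EFin_Rintegral_indic msq Qsq mAB).
congr EFin.
have cvgAB (nu : {finite_measure set RR -> \bar R}) :
    \int[nu]_(z in sq) (ramp f n z.1 * ramp g n z.2) @[n --> \oo] -->
    \int[nu]_(z in sq) (\1_(A `*` B) z : R).
  apply: Rintegral_dominated_cvg => //.
  - move=> n.
    have bramp (h : R -> R) : continuous_periodic h -> bounded_measurable I (ramp h n).
      by move=> [ch _]; apply: bounded_measurable_continuous; exact: continuous_ramp.
    by have [] := bounded_measurable_prod mI mI (bramp _ cpf) (bramp _ cpg).
  - move=> n z _; rewrite ger0_norm ?mulr_ge0 ?ramp_ge0//.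
    by rewrite mulr_ile1 ?ramp_ge0 ?ramp_le1.
  - move=> [x y] [/= Ix Iy].
    have -> : (\1_(A `*` B) (x, y) : R) = (0 < f x)%R%:R * (0 < g y)%R%:R.
      by rewrite indicE in_setX/= fA// gB// -natrM mulnb.
    by apply: cvgM; exact: cvg_ramp.
have := cvgAB P.
have -> : (fun n => \int[P]_(z in sq) (ramp f n z.1 * ramp g n z.2)) =
          (fun n => \int[Q]_(z in sq) (ramp f n z.1 * ramp g n z.2)).
  apply/funext => n; have cpramp (h : R -> R) : continuous_periodic h ->
      continuous_periodic (ramp h n).
    by move=> [ch ph]; split; [exact: continuous_ramp|exact: periodic_ramp].
  exact: (same_integral_continuous (cpramp _ cpf) (cpramp _ cpg)).2.
by move=> /cvg_unique; apply; [exact: Rhausdorff|exact: cvgAB].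
Qed.

(** Rectangles with circle sets as sides are stable under intersection and
generate the Borel sets, hence it suffices to compare P and Q on them. *)
Lemma eq_measure_of_derivatives X : measurable X -> P X = Q X.
Proof.
have mcs := @measurable_circle_set R.
have csT := @circle_setT R.
apply: (measure_unique [set A `*` B | A in @circle_set R & B in @circle_set R]
  (fun=> setT)).
- exact: measurable_prod_generated.
- move=> _ _ [A1 cA1 [B1 cB1 <-]] [A2 cA2 [B2 cB2 <-]].
  exists (A1 `&` A2); first exact: setI_closed_circle_set.
  exists (B1 `&` B2); first exact: setI_closed_circle_set.
  by rewrite setXI.
- by move=> _; exists setT => //; exists setT => //; rewrite setXTT.
- by rewrite bigcup_const.
- by move=> _ [A cA [B cB <-]]; exact: same_rectangle.
- by move=> _; rewrite -ge0_fin_numE// fin_num_measure.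
Qed.

End uniqueness.

Lemma fin_num_sube0 (R : realType) (x y : \bar R) :
  x \is a fin_num -> y \is a fin_num -> (x - y = 0 -> x = y)%E.
Proof.
move: x y => [x| |] [y| |]// _ _; rewrite -EFinB => -[/eqP].
by rewrite subr_eq0 => /eqP ->.
Qed.

Section mixing_unique.
Context (R : realType) (mu : probability (measurableTypeR R) R).
Local Notation I := (unit_itv R).
Local Notation sq := (unit_square R).
Local Notation RR := (measurableTypeR R * measurableTypeR R)%type.
Implicit Types lam : {charge set RR -> \bar R}.
Let mI := @measurable_unit_itv R.
Let msq := @measurable_unit_square R.

Lemma bounded_measurable_derive1_prod (u v : R -> R) :
  periodic_C1 u -> periodic_C1 v ->
  bounded_measurable sq (fun z : RR => derive1 u z.1 * derive1 v z.2).
Proof.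
move=> [du cu _] [dv cv _].
exact: (bounded_measurable_prod mI mI (bounded_measurable_continuous cu)
  (bounded_measurable_continuous cv)).
Qed.

(** The difference of the two measures has a Jordan decomposition P0 - Q0, and
the claim becomes an equality of two positive measures. *)
Lemma mixing_measure_unique lam1 lam2 :
  mixing_measure mu lam1 -> mixing_measure mu lam2 ->
  (forall A, measurable A -> marginal lam1 A = marginal lam2 A) ->
  forall A, measurable A -> lam1 A = lam2 A.
Proof.
move=> [car1 sym1 int1] [car2 sym2 int2] lam12.
pose delta : {charge set RR -> \bar R} := cadd lam1 (cscale (-1) lam2).
have deltaE A : delta A = (lam1 A - lam2 A)%E.
  by rewrite /delta/= /cadd/= cscaleN1.
have [P0 [Q0 [deltaPQ intPQ]]] := charge_jordanE delta.
have eqPQ A : measurable A -> lam1 A = lam2 A -> P0 A = Q0 A.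
  move=> mA lamA; have := deltaPQ _ mA; rewrite deltaE lamA.
  rewrite subee ?fin_num_measure// => /esym.
  by apply: fin_num_sube0; exact: fin_num_measure.
pose P := mrestr P0 msq; pose Q := mrestr Q0 msq.
have restr0 (nu : {finite_measure set RR -> \bar R}) : mrestr nu msq (~` sq) = 0%E.
  by rewrite /mrestr setICl measure0.
have rectE (A : set (measurableTypeR R)) : fst @^-1` A `&` sq = (A `&` I) `*` I.
  apply/seteqP; split=> -[x y] /=; rewrite /unit_square/=.
    by move=> [Ax [Ix Iy]].
  by move=> [[Ax Ix] Iy].
have PQfst (A : set (measurableTypeR R)) : measurable A ->
    P (fst @^-1` A) = Q (fst @^-1` A).
  move=> mA; have mAI : measurable (A `&` I) by exact: measurableI.
  rewrite /P /Q /mrestr rectE; apply: eqPQ; first exact: measurableX.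
  exact: lam12.
(* The second marginals agree by symmetry. *)
have PQsnd (A : set (measurableTypeR R)) : measurable A ->
    P (snd @^-1` A) = Q (snd @^-1` A).
  move=> mA; have mAI : measurable (A `&` I) by exact: measurableI.
  have swapE : snd @^-1` A `&` sq = [set z : RR | ((A `&` I) `*` I) (z.2, z.1)].
    apply/seteqP; split=> -[x y] /=; rewrite /unit_square/=.
      by move=> [Ay [Ix Iy]].
    by move=> [[Ay Iy] Ix].
  have mAII : measurable ((A `&` I) `*` I) by exact: measurableX.
  rewrite /P /Q /mrestr swapE; apply: eqPQ; last first.
    by rewrite sym1// sym2//; exact: lam12.
  rewrite -swapE; apply: measurableI => //.
  by rewrite -[X in measurable X]setTI; exact: measurable_snd.
have PQint (u v : R -> R) : periodic_C1 u -> periodic_C1 v ->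
    \int[P]_(z in sq) (derive1 u z.1 * derive1 v z.2) =
    \int[Q]_(z in sq) (derive1 u z.1 * derive1 v z.2).
  move=> pu pv; have buv := bounded_measurable_derive1_prod pu pv.
  have restrE (nu : {finite_measure set RR -> \bar R}) (h : RR -> R) :
      \int[mrestr nu msq]_(z in sq) h z = \int[nu]_(z in sq) h z.
    rewrite /Rintegral; congr fine; apply: eq_measure_integral => A mA Asq.
    by rewrite /= /mrestr setIidl.
  rewrite !restrE; apply/eqP; rewrite -subr_eq0 -intPQ.
  rewrite charge_Rintegral_cadd// charge_Rintegral_cscale//.
  by rewrite -int1// -int2// mulN1r subrr.
move=> A mA; have mAsq : measurable (A `&` sq) by exact: measurableI.
have := eq_measure_of_derivatives (restr0 P0) (restr0 Q0) PQfst PQsnd PQint mA.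
rewrite /= /mrestr => PQA; have := deltaPQ _ mAsq.
rewrite PQA subee ?fin_num_measure// deltaE -car1// -car2//.
by apply: fin_num_sube0; exact: fin_num_measure.
Qed.

End mixing_unique.

(** * Existence *)

Section swap.
Context (R : realType).
Local Notation RR := (measurableTypeR R * measurableTypeR R)%type.
Local Notation I := (unit_itv R).
Local Notation sq := (unit_square R).
Let mI := @measurable_unit_itv R.
Let msq := @measurable_unit_square R.

Lemma measurable_swap : measurable_fun setT (fun z : RR => (z.2, z.1)).
Proof.
by apply: measurable_fun_pair; [exact: measurable_snd|exact: measurable_fst].
Qed.

Lemma finite_product_swap
    (a b : {finite_measure set (measurableTypeR R) -> \bar R}) (X : set RR) :
  measurable X ->
  finite_product a b [set z | X (z.2, z.1)] = finite_product b a X.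
Proof.
move=> mX; apply/esym.
have := @product_measure_unique _ _ _ _ R b a
  (pushforward (finite_product a b) (fun z : RR => (z.2, z.1))).
move=> /(_ measurable_swap); apply=> //.
move=> A B mA mB; rewrite /= /pushforward.
have -> : (fun z : RR => (z.2, z.1)) @^-1` (A `*` B) = B `*` A.
  by apply/seteqP; split=> -[x y] /= [].
by rewrite /finite_product product_measure1E// muleC.
Qed.

Lemma finite_product_carried
    (a b : {finite_measure set (measurableTypeR R) -> \bar R}) :
  carried_by I a -> carried_by I b -> carried_by sq (finite_product a b).
Proof.
move=> ca cb X mX; rewrite /finite_product.
rewrite (product_measure_unique (m' := mrestr (a \x b)%E msq))//.
move=> A B mA mB; rewrite /= /mrestr /unit_square -setXI product_measure1E//.
- by congr (_ * _)%E; apply/esym; [exact: ca|exact: cb].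
- exact: measurableI.
- exact: measurableI.
Qed.

End swap.

Section hoeffding_symmetry.
Context (R : realType) (mu : probability (measurableTypeR R) R).
Local Notation RR := (measurableTypeR R * measurableTypeR R)%type.
Local Notation I := (unit_itv R).
Local Notation sq := (unit_square R).
Local Notation m := (unit_lebesgue R).
Local Notation mm := (finite_product m m).

Lemma hoeffding_carried : carried_by sq (hoeffding mu).
Proof. by move=> A mA; rewrite /= /hoeffding -setIA setIid. Qed.

(** The density is symmetric, and so is the square of the uniform measure. *)
Lemma hoeffding_swap (A : set RR) : measurable A ->
  hoeffding mu [set z | A (z.2, z.1)] = hoeffding mu A.
Proof.
move=> mA; have mswap := @measurable_swap R.
have mA' : measurable [set z : RR | A (z.2, z.1)].
  by rewrite -[X in measurable X]setTI; exact: mswap.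
have bH := bounded_measurable_hoeffding_density mu setT.
rewrite !hoeffdingE//.
have HS (z : RR) : hoeffding_density mu z = hoeffding_density mu (z.2, z.1).
  by rewrite /hoeffding_density/= minC maxC.
under [LHS]eq_integral do rewrite HS.
have mH : measurable_fun [set: RR] (EFin \o hoeffding_density mu).
  by apply/measurable_EFinP; case: bH.
have iH : mm.-integrable ((fun z : RR => (z.2, z.1)) @^-1` A)
    ((EFin \o hoeffding_density mu) \o (fun z : RR => (z.2, z.1))).
  apply: (@bounded_measurable_integrable _ _ _ _
    (hoeffding_density mu \o (fun z : RR => (z.2, z.1)))) => //.
  exact: (bounded_measurable_comp measurableT mswap (fun _ _ => Logic.I) bH).
rewrite -(integral_pushforward mswap mH iH mA).
apply: eq_measure_integral => B mB _; exact: finite_product_swap.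
Qed.

End hoeffding_symmetry.

Section variance.
Context (R : realType) (mu : probability (measurableTypeR R) R).
Hypothesis hmu : carried_by (unit_itv R) mu.
Local Notation RR := (measurableTypeR R * measurableTypeR R)%type.
Local Notation I := (unit_itv R).
Local Notation sq := (unit_square R).
Let mI := @measurable_unit_itv R.

Lemma integral_carried (f : R -> R) : continuous f ->
  (\int[mu]_x (f x)%:E = \int[mu]_(x in I) (f x)%:E)%E.
Proof.
move=> cf; rewrite [RHS]integral_mkcond.
have mf : measurable_fun [set: measurableTypeR R] (EFin \o f).
  by apply/measurable_EFinP; exact: continuous_measurable_fun.
apply: ae_eq_integral => //.
  by apply/(measurable_restrictT _ mI); apply: measurable_funTS.
exists (~` I); split; first exact: measurableC.
  by have := hmu (measurableC mI); rewrite setICl measure0.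
move=> x /= nx Ix; apply: nx => _.
by rewrite patchE mem_set.
Qed.

Lemma cov_unit_itv (u v : R -> R) : continuous u -> continuous v ->
  cov mu u v = \int[mu]_(x in I) (u x * v x) -
    (\int[mu]_(x in I) u x) * (\int[mu]_(x in I) v x).
Proof.
move=> cu cv; rewrite /cov /Rintegral !integral_carried//.
by move=> x; apply: cvgM; [exact: cu|exact: cv].
Qed.

(** Hoeffding's formula for two identity functions. *)
Lemma variance_hoeffding :
  variance mu (idfun : measurableTypeR R -> R) = hoeffding mu sq.
Proof.
have did : continuously_derivable (id : R -> R).
  split=> [x|]; first exact: derivable_id.
  have -> : derive1 (id : R -> R) = cst 1.
    by apply/funext => x; rewrite derive1E derive_id.
  by move=> x; exact: cvg_cst.
have cid : continuous (id : R -> R) by move=> x; exact: cvg_id.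
have := Rintegral_hoeffding hmu did did.
have -> : derive1 (id : R -> R) = cst 1.
  by apply/funext => x; rewrite derive1E derive_id.
rewrite /variance covariance.unlock expectation.unlock.
set e := \int[mu]_(x in I) x.
have -> : fine (\int[mu]_x (idfun x)%:E)%E = e.
  by rewrite /e /Rintegral -integral_carried.
have cde : continuous (fun x : R => (x - e) * (x - e)).
  by move=> x; apply: cvgM; apply: cvgB; try exact: cvg_id; exact: cvg_cst.
rewrite [X in _ -> X = _](integral_carried cde).
have bid := bounded_measurable_continuous cid.
have bcst (r : R) := bounded_measurable_cst I r.
have bide : bounded_measurable I (fun x : R => (x - e) * (x - e)).
  exact: bounded_measurable_continuous.
have intI f : bounded_measurable I f -> mu.-integrable I (EFin \o f).
  exact: bounded_measurable_integrable.
have mu1 : \int[mu]_(x in I) 1 = 1 :> R.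
  rewrite Rintegral_cst// mul1r.
  by have /(congr1 fine) h := carried_by_unit_itv1 hmu; exact: h.
have -> : (\int[mu]_(x in I) ((x - e) * (x - e))%:E)%E =
    (\int[mu]_(x in I) (x * x) - e * e)%:E.
  rewrite -(EFin_Rintegral mI mu bide); congr EFin.
  have bxx : bounded_measurable I (fun x : R => x * x).
    exact: bounded_measurable_continuous (fun x => cvgM (cid x) (cid x)).
  have b2 : bounded_measurable I (fun x : R => (2 * e) * x).
    exact: bounded_measurableM.
  have b3 : bounded_measurable I (fun x : R => (e * e) * 1).
    exact: bounded_measurableM.
  transitivity (\int[mu]_(x in I) ((x * x - (2 * e) * x) + (e * e) * 1)).
    by apply: eq_Rintegral => x _; ring.
  rewrite RintegralD//; try by apply: intI; try exact: bounded_measurableB.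
  rewrite RintegralB//; try exact: intI.
  rewrite !RintegralZl//; try exact: intI.
  by rewrite mu1 -/e; ring.
move=> <-; have msq := @measurable_unit_square R.
under eq_Rintegral do rewrite /cst mulr1.
rewrite Rintegral_cst// mul1r fineK//.
by rewrite fin_num_measure.
Qed.

End variance.

Section candidate.
Context (R : realType) (mu : probability (measurableTypeR R) R) (c : R).
Hypothesis hmu : carried_by (unit_itv R) mu.
Local Notation RR := (measurableTypeR R * measurableTypeR R)%type.
Local Notation I := (unit_itv R).
Local Notation sq := (unit_square R).
Local Notation m := (unit_lebesgue R).
Local Notation Lambda := (marginal (hoeffding mu)).
Let mI := @measurable_unit_itv R.
Let msq := @measurable_unit_square R.
Let sigma2 : R := fine (hoeffding mu sq).
Local Notation cprod a b :=
  (charge_of_finite_measure (finite_product a b) : {charge set RR -> \bar R}).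

Definition mixing_candidate : {charge set RR -> \bar R} :=
  cadd (cadd (cadd (charge_of_finite_measure (hoeffding mu))
    (cscale (sigma2 - c) (cprod m m)))
    (cscale c (cadd (cprod mu m) (cprod m mu))))
    (cscale (-1) (cadd (cprod Lambda m) (cprod m Lambda))).

Lemma mixing_candidateE A : mixing_candidate A = (hoeffding mu A
  + (hoeffding mu sq - c%:E) * finite_product m m A
  + c%:E * (finite_product mu m A + finite_product m mu A)
  - (finite_product Lambda m A + finite_product m Lambda A))%E.
Proof.
have -> : hoeffding mu sq = sigma2%:E.
  by rewrite /sigma2 fineK//; exact: fin_num_measure.
by rewrite -EFinB -[X in (_ + X)%E]mulN1e.
Qed.

Lemma unit_lebesgue_carried : carried_by I m.
Proof. by move=> A mA; rewrite /= /unit_lebesgue /mfrestr /mrestr -setIA setIid. Qed.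

Lemma marginal_hoeffding_carried : carried_by I Lambda.
Proof.
move=> A mA; have mAI : measurable (A `&` I) by exact: measurableI.
rewrite /marginal hoeffding_carried; last exact: measurableX.
rewrite [RHS]hoeffding_carried; last exact: measurableX.
by rewrite /unit_square -!setXI -setIA setIid.
Qed.

Lemma mixing_candidate_carried : carried_by sq mixing_candidate.
Proof.
have cm := unit_lebesgue_carried; have cL := marginal_hoeffding_carried.
move=> A mA; rewrite [LHS]mixing_candidateE [RHS]mixing_candidateE.
have e0 : hoeffding mu (A `&` sq) = hoeffding mu A by rewrite -hoeffding_carried.
have e1 : finite_product m m (A `&` sq) = finite_product m m A.
  exact: esym (finite_product_carried cm cm mA).
have e2 : finite_product mu m (A `&` sq) = finite_product mu m A.
  exact: esym (finite_product_carried hmu cm mA).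
have e3 : finite_product m mu (A `&` sq) = finite_product m mu A.
  exact: esym (finite_product_carried cm hmu mA).
have e4 : finite_product Lambda m (A `&` sq) = finite_product Lambda m A.
  exact: esym (finite_product_carried cL cm mA).
have e5 : finite_product m Lambda (A `&` sq) = finite_product m Lambda A.
  exact: esym (finite_product_carried cm cL mA).
by rewrite e0 e1 e2 e3 e4 e5.
Qed.

Lemma mixing_candidate_swap A : measurable A ->
  mixing_candidate [set z | A (z.2, z.1)] = mixing_candidate A.
Proof.
move=> mA; rewrite [LHS]mixing_candidateE [RHS]mixing_candidateE.
have swapE a b := @finite_product_swap R a b A mA.
rewrite (hoeffding_swap mu mA) (swapE m m) (swapE mu m) (swapE m mu).
rewrite (swapE Lambda m) (swapE m Lambda).
rewrite [X in (c%:E * X)%E]addeC; congr (_ - _)%E; exact: addeC.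
Qed.

(** Every term but the Hoeffding measure has a uniform factor, against which the
derivative of a periodic function integrates to zero. *)
Lemma mixing_candidate_cov (u v : R -> R) : periodic_C1 u -> periodic_C1 v ->
  cov mu u v = charge_Rintegral mixing_candidate sq
    (fun z => derive1 u z.1 * derive1 v z.2).
Proof.
move=> pu pv; have bu'v' := bounded_measurable_derive1_prod pu pv.
case: pu => du cu pu; case: pv => dv cv pv.
have bu' := bounded_measurable_continuous cu.
have bv' := bounded_measurable_continuous cv.
have cont (w : R -> R) : (forall x, derivable w x 1) -> continuous w.
  by move=> dw x; exact/differentiable_continuous/derivable1_diffP.
have u0 := Rintegral_derive1_periodic (conj du cu) pu.
have v0 := Rintegral_derive1_periodic (conj dv cv) pv.
have prod_m (a : {finite_measure set (measurableTypeR R) -> \bar R}) :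
    \int[finite_product a m]_(z in sq) (derive1 u z.1 * derive1 v z.2) = 0.
  by rewrite (Rintegral_prodM _ _ mI mI bu' bv') v0 mulr0.
have m_prod (a : {finite_measure set (measurableTypeR R) -> \bar R}) :
    \int[finite_product m a]_(z in sq) (derive1 u z.1 * derive1 v z.2) = 0.
  by rewrite (Rintegral_prodM _ _ mI mI bu' bv') u0 mul0r.
rewrite /mixing_candidate.
rewrite !(charge_Rintegral_cadd msq _ _ bu'v', charge_Rintegral_cscale msq _ _ bu'v').
rewrite !(charge_Rintegral_measure msq _ bu'v').
rewrite !prod_m !m_prod (Rintegral_hoeffding hmu (conj du cu) (conj dv cv)).
rewrite (cov_unit_itv hmu (cont _ du) (cont _ dv)); ring.
Qed.

(** The coefficient sigma2 - c cancels c mu I = c and the total mass sigma2 of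
Lambda in front of m, and Lambda itself cancels the marginal of the Hoeffding
measure. *)
Lemma mixing_candidate_marginal A : measurable A ->
  marginal mixing_candidate A = (c%:E * mu A)%E.
Proof.
move=> mA; rewrite /marginal mixing_candidateE.
have mAI : measurable (A `*` I) by exact: measurableX.
have prodE (a b : {finite_measure set (measurableTypeR R) -> \bar R}) :
    finite_product a b (A `*` I) = (a A * b I)%E.
  by rewrite /finite_product product_measure1E.
rewrite !prodE.
have mI1 : m I = 1%E.
  by rewrite /unit_lebesgue /mfrestr /mrestr setIid lebesgue_measure_unit_itv.
have LI : Lambda I = hoeffding mu sq by [].
have LA : Lambda A = hoeffding mu (A `*` I) by [].
have [x xE] : exists x, hoeffding mu (A `*` I) = x%:E.
  by exists (fine (hoeffding mu (A `*` I))); rewrite fineK//; exact: fin_num_measure.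
have [y yE] : exists y, hoeffding mu sq = y%:E.
  by exists (fine (hoeffding mu sq)); rewrite fineK//; exact: fin_num_measure.
have [z zE] : exists z, mu A = z%:E.
  by exists (fine (mu A)); rewrite fineK//; exact: fin_num_measure.
have [t tE] : exists t, m A = t%:E.
  by exists (fine (m A)); rewrite fineK//; exact: fin_num_measure.
rewrite /= mI1 LI LA (carried_by_unit_itv1 hmu) xE yE zE tE !mule1.
by rewrite -!(EFinB, EFinM, EFinD); congr EFin; ring.
Qed.

End candidate.

Local Open Scope ring_scope.
Local Open Scope ereal_scope.

Theorem theorem5p1 (R : realType) (mu : probability (measurableTypeR R) R)
    (hmu : carried_by (unit_itv R) mu) (c : R) :
  let m : set (measurableTypeR R) -> \bar R := unit_lebesgue R in
  let Lambda : set (measurableTypeR R) -> \bar R := marginal (hoeffding mu) in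
  let sigma2 : \bar R := variance mu (idfun : measurableTypeR R -> R) in
  exists lambda :
      {charge set (measurableTypeR R * measurableTypeR R)%type -> \bar R},
    [/\ mixing_measure mu lambda,
        forall A, measurable A -> marginal lambda A = c%:E * mu A,
        forall lambda' :
            {charge set (measurableTypeR R * measurableTypeR R)%type -> \bar R},
          mixing_measure mu lambda' ->
          (forall A, measurable A -> marginal lambda' A = c%:E * mu A) ->
          forall A, measurable A -> lambda' A = lambda A
      & forall A, measurable A ->
          lambda A = hoeffding mu A
                   + (sigma2 - c%:E) * (m \x m) A
                   + c%:E * ((mu \x m) A + (m \x mu) A)
                   - ((Lambda \x m) A + (m \x Lambda) A)].
Proof.
move=> m Lambda sigma2; exists (mixing_candidate mu c).
have mixing : mixing_measure mu (mixing_candidate mu c).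
  split; [exact: mixing_candidate_carried|exact: mixing_candidate_swap|].
  by move=> u v pu pv; exact: mixing_candidate_cov.
split=> //.
- exact: mixing_candidate_marginal.
- move=> lambda' mixing' marg'; apply: mixing_measure_unique mixing' mixing _.
  by move=> A mA; rewrite marg'// mixing_candidate_marginal.
- by move=> A mA; rewrite /sigma2 variance_hoeffding// mixing_candidateE.
Qed.
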